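(* Let $G=(V,E,s,t)$ be a directed multigraph with finite arc set $E$ and two distinguished vertices $s,t\in V$ (possibly equal). Let $V'$ be the set of nonsinks of $G$, let $\mathcal{PM}(G)$ be the path-missing complex of $G$, and let $\widetilde{\chi}$ denote the reduced Euler characteristic. (a) If $G$ contains a useless arc or a cycle, or satisfies ($E=\varnothing$ and $s\neq t$), then $\widetilde{\chi}(\mathcal{PM}(G))=0$. (b) Otherwise, $\widetilde{\chi}(\mathcal{PM}(G))=(-1)^{\#E-\#V'+1}$.
   Context: Graphs are directed multigraphs; each arc has a source and a target in $V$; parallel arcs and self-loops are allowed. A walk from $v_0$ to $v_n$ is a sequence $(v_0,e_1,v_1,\ldots,e_n,v_n)$ with $n\ge 0$, $v_i\in V$, $e_i\in E$, where each $e_i$ is an arc from $v_{i-1}$ to $v_i$. A path is a walk that does not visit any vertex more than once; an $s-t$-path is a path from $s$ to $t$ (if $s=t$, this is the trivial path with no arcs). A cycle is a walk with $n\ge1$, $v_0=v_n$ and $v_0,\ldots,v_{n-1}$ distinct (so a self-loop gives a cycle). A nonsink is a vertex that is the source of at least one arc. A useless arc is an arc that belongs to no $s-t$-path. A set $F\subseteq E$ contains a path if it contains every arc of it. A simplicial complex on a finite ground set $W$ is a set $\Delta$ of subsets of $W$ (its faces) closed under taking subsets; $\Delta=\varnothing$ is allowed, as is $\Delta=\{\varnothing\}$, and singletons need not be faces. The path-missing complex is $\mathcal{PM}(G)=\{F\subseteq E : E\setminus F \text{ contains an } s-t\text{-path}\}$, with ground set $E$. The reduced Euler characteristic is $\widetilde{\chi}(\Delta)=\sum_{I\in\Delta}(-1)^{\#I-1}$.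 *)

(* Defs.v *)
From mathcomp Require Import all_boot all_order all_algebra.
From mathcomp Require Import boolp.
Set Implicit Arguments.
Unset Strict Implicit.
Unset Printing Implicit Defensive.
Import Order.TTheory GRing.Theory Num.Theory.
Local Open Scope ring_scope.

(* The vertex type may be infinite; only the arcs are required to be finite.  *)
Record digraph (V : eqType) (E : finType) := Digraph {
  source : E -> V;
  target : E -> V;
  start : V;
  terminus : V
}.

Section Digraph.
Variables (V : eqType) (E : finType) (G : digraph V E).

(* A walk (v_0, e_1, v_1, ..., e_n, v_n) is represented by v_0 and            *)
(* p = [:: e_1; ...; e_n]: the vertices v_i with i >= 1 are forced to be the  *)
(* targets of the arcs e_i, so that v_1, ..., v_n is map (target G) p.        *)
Fixpoint is_walk (u v : V) (p : seq E) : bool :=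
  if p is e :: q then (source G e == u) && is_walk (target G e) v q
  else u == v.

Definition is_path (u v : V) (p : seq E) : bool :=
  is_walk u v p && uniq (u :: map (target G) p).

(* belast v (map (target G) p) is the list v_0, ..., v_(n-1).                 *)
Definition is_cycle (v : V) (p : seq E) : bool :=
  [&& is_walk v v p, (0 < size p)%N & uniq (belast v (map (target G) p))].

Definition is_st_path (p : seq E) : bool := is_path (start G) (terminus G) p.

Definition useless (e : E) : Prop := ~ exists p, is_st_path p /\ e \in p.

Definition has_cycle : Prop := exists v p, is_cycle v p.

Definition contains_st_path (F : {set E}) : Prop :=
  exists p, is_st_path p /\ {subset p <= F}.

Definition path_missing : {set {set E}} :=
  [set F : {set E} | `[< contains_st_path (~: F) >]].

Definition nonsink (v : V) : bool := [exists e, source G e == v].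

(* Duplicate-free list of the nonsinks, see mem_nonsinks and uniq_nonsinks.   *)
Definition nonsinks : seq V := undup (codom (source G)).

Lemma mem_nonsinks v : (v \in nonsinks) = nonsink v.
Proof.
rewrite mem_undup; apply/codomP/existsP => [[e ->]|[e /eqP <-]]; by exists e.
Qed.

Lemma uniq_nonsinks : uniq nonsinks.
Proof. exact: undup_uniq. Qed.

End Digraph.

Definition simplicial_complex (W : finType) (D : {set {set W}}) : Prop :=
  forall I J : {set W}, J \in D -> I \subset J -> I \in D.

Lemma path_missing_complex (V : eqType) (E : finType) (G : digraph V E) :
  simplicial_complex (path_missing G).
Proof.
move=> I J; rewrite !inE => /asboolP[p [st_p pJ]] sIJ; apply/asboolP.
exists p; split=> // e /pJ; rewrite !inE; exact/contra/(subsetP sIJ).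
Qed.

(* The exponent is an integer: the empty face contributes (-1) ^ -1 = -1.     *)
Definition reduced_euler_char (W : finType) (D : {set {set W}}) : int :=
  \sum_(I in D) (-1 : int) ^ (#|I|%:Z - 1).

(* Main.v *)
Require Import Defs.
From mathcomp Require Import all_boot all_order all_algebra.
From mathcomp Require Import boolp zify.
Local Open Scope ring_scope.

(** Passing to complements, the Euler characteristic is, up to sign, the sum of
[(-1)^#|A|] over the arc sets [A] along which [t] can be reached from [s].
Replace [s] by a set [S] of starting vertices and call this sum [g S X] when
[A] ranges over the subsets of [X].  It vanishes as soon as some arc of [X] can
be toggled without affecting reachability, for instance an arc ending in [S].
If [e] in [X] goes from [S] to [v], then
[g S X = g S (X :\ e) - g (v :: S) (X :\ e)].
When [X] contains a cycle and no arc ends in [S], the arc [e] is not on the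
cycle, so both terms vanish by induction.  When [X] is acyclic and has no
useless arc, exactly one term survives: the first if another arc of [X] ends at
[v] (it can be toggled in the second term), the second otherwise, and then one
nonsink is absorbed into [S], or [v] is the terminus and [X] is [[set e]]. *)

Set Implicit Arguments.
Unset Strict Implicit.
Unset Printing Implicit Defensive.
Import Order.TTheory GRing.Theory Num.Theory.

Lemma sign_exprzD (m n : int) : (-1 : int) ^ (m + n) = (-1) ^ m * (-1) ^ n.
Proof. by rewrite exprzDr // unitrN unitr1. Qed.

(** * Alternating sums over the subsets of a finite set *)

Section AlternatingSum.
Variable E : finType.
Implicit Types (X A : {set E}) (P Q : {set E} -> bool).

Definition alt_sum X P : int := \sum_(A : {set E} | A \subset X) (-1) ^+ #|A| *+ P A.

Lemma eq_alt_sum X P Q :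
  (forall A, A \subset X -> P A = Q A) -> alt_sum X P = alt_sum X Q.
Proof. by move=> PQ; apply: eq_bigr => A /PQ ->. Qed.

Lemma alt_sum_false X P : (forall A, A \subset X -> P A = false) -> alt_sum X P = 0.
Proof. by move=> P0; apply: big1 => A /P0 ->. Qed.

Lemma alt_sum_set0 P : alt_sum set0 P = (P set0)%:R.
Proof.
by rewrite /alt_sum (big_pred1 set0) ?cards0 // => A; rewrite subset0.
Qed.

(** Split the subsets of [X] by whether they contain [e]; inserting [e] flips the sign. *)
Lemma alt_sumD1 X P e : e \in X ->
  alt_sum X P = alt_sum (X :\ e) P - alt_sum (X :\ e) (fun A => P (e |: A)).
Proof.
move=> Xe; rewrite /alt_sum (bigID (fun A : {set E} => e \in A)) /= addrC.
congr (_ + _); first by apply: eq_bigl => A; rewrite subsetD1.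
rewrite -sumrN (reindex_onto (fun A => e |: A) (fun A => A :\ e)) /=; last first.
  by move=> A /andP[_ eA]; rewrite setD1K.
rewrite (eq_bigl (fun A : {set E} => A \subset X :\ e)); last first.
  move=> A; rewrite subUset sub1set Xe setU11 andbT subsetD1 /=.
  have [eA|eA] := boolP (e \in A).
    by rewrite andbF; apply/andP => -[_ /eqP/setP/(_ e)]; rewrite !inE eqxx eA.
  by rewrite setU1K // eqxx !andbT.
apply: eq_bigr => A; rewrite subsetD1 => /andP[_ eA].
by rewrite cardsU1 eA exprS mulN1r mulNrn.
Qed.

Lemma alt_sum_toggle X P e : e \in X ->
  (forall A, A \subset X :\ e -> P (e |: A) = P A) -> alt_sum X P = 0.
Proof. by move=> Xe /eq_alt_sum PE; rewrite (alt_sumD1 _ Xe) PE subrr. Qed.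

End AlternatingSum.

(** * Walks, paths and cycles *)

Section Walks.
Variables (V : eqType) (E : finType) (G : digraph V E).
Implicit Types (u v : V) (e f : E) (p q : seq E) (S N : seq V) (A B X : {set E}).
Local Notation src := (source G).
Local Notation tgt := (target G).
Local Notation t := (terminus G).

Lemma is_walk_cat u v p q : is_walk G u v (p ++ q) =
  is_walk G u (last u (map tgt p)) p && is_walk G (last u (map tgt p)) v q.
Proof. by elim: p u => [|e p IH] u /=; rewrite ?eqxx // IH andbA. Qed.

Lemma walk_last u v p : is_walk G u v p -> last u (map tgt p) = v.
Proof. by elim: p u => [|e p IH] u /= => [/eqP|/andP[_ /IH]]. Qed.

Lemma walk_belast u v p : is_walk G u v p -> belast u (map tgt p) = map src p.
Proof. by elim: p u => //= e p IH u /andP[/eqP -> /IH ->]. Qed.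

Lemma walk_source u v p e : is_walk G u v p -> e \in p ->
  src e = u \/ exists2 f, f \in p & tgt f = src e.
Proof.
elim: p u => //= f p IH u /andP[/eqP fu wp]; rewrite inE => /orP[/eqP ->|ep].
  by left.
right; have [->|[g gp <-]] := IH _ wp ep; first by exists f; rewrite ?mem_head.
by exists g; rewrite // inE gp orbT.
Qed.

Lemma walk_target u v p e : is_walk G u v p -> e \in p ->
  tgt e = v \/ exists2 f, f \in p & src f = tgt e.
Proof.
elim: p u => //= f p IH u /andP[/eqP fu wp]; rewrite inE => /orP[/eqP ->|ep].
  case: p wp {IH} => [/eqP|g p /= /andP[/eqP <- _]]; first by left.
  by right; exists g; rewrite // !inE eqxx orbT.
have [->|[g gp <-]] := IH _ wp ep; first by left.
by right; exists g; rewrite // inE gp orbT.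
Qed.

(** Induction on the walk: [u] is put in front of the path found for the rest, unless that path
    already visits [u]; then only its part from that visit on is kept. *)
Lemma walk_to_path u v p : is_walk G u v p ->
  exists2 q, is_path G u v q & {subset q <= p}.
Proof.
elim: p u => [|e p IH] u /=.
  by move=> /eqP ->; exists [::] => //; rewrite /is_path /= eqxx.
case/andP=> /eqP eu /IH[q /andP[wq uq] qp].
have [uE|uN] := boolP (u \in tgt e :: map tgt q); last first.
  exists (e :: q); first by rewrite /is_path cons_uniq uN uq /= eu eqxx wq.
  by move=> f; rewrite !inE => /orP[->//|/qp ->]; rewrite orbT.
move: uE; rewrite inE => /orP[/eqP ->|/mapP[f fq ->]].
  by exists q; [rewrite /is_path wq uq | move=> f /qp fp; rewrite inE fp orbT].
case/splitPr: fq wq uq qp => q1 q2 wq uq qp; exists q2; last first.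
  by move=> g gq; rewrite inE qp ?orbT // mem_cat inE gq !orbT.
move: wq uq; rewrite is_walk_cat /is_path /= => /and3P[_ _ ->].
by rewrite map_cat cat_uniq /= => /andP[_ /and4P[_ _ -> ->]].
Qed.

(** By induction only the source of the first arc needs to recur; the arcs before its recurrence
    form a cycle. *)
Lemma walk_sources_uniq u v p :
  is_walk G u v p -> ~~ uniq (map src p) -> has_cycle G.
Proof.
elim: p u => //= e p IH u /andP[/eqP eu wp]; rewrite negb_and negbK.
have [up|/(IH _ wp)//] := boolP (uniq (map src p)).
rewrite /= orbF => /mapP[f fp esf]; case/splitPr: fp wp up => p1 p2.
rewrite is_walk_cat /= map_cat cat_uniq => /and3P[wp1 /eqP fs _].
case/and3P=> u1 /hasPn/(_ (src f)) + _; rewrite /= mem_head => /(_ isT) fp1.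
exists u, (e :: p1); rewrite /is_cycle.
have wc : is_walk G u u (e :: p1) by rewrite /= eu eqxx /= -{1}eu esf fs.
by rewrite wc (walk_belast wc) /= esf fp1 u1.
Qed.

(** If every arc of [B] had a predecessor in [B], walks could be prolonged backwards without end. *)
Lemma acyclic_minimal B : ~ has_cycle G -> B != set0 ->
  exists2 e, e \in B & forall f, f \in B -> tgt f != src e.
Proof.
move=> acyc /set0Pn[b bB]; apply: contrapT => noMin.
have pred e : e \in B -> exists2 f, f \in B & tgt f = src e.
  move=> eB; apply: contrapT => noPred; apply: noMin; exists e => // f fB.
  by apply/eqP => fe; apply: noPred; exists f.
have long n : exists e p, [/\ e \in B, size p = n & is_walk G (src e) (tgt b) (e :: p)].
  elim: n => [|n [e [p [eB sp wp]]]].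
    by exists b, [::]; rewrite /= !eqxx.
  have [f fB fe] := pred _ eB; exists f, (e :: p); split=> //.
    by rewrite /= sp.
  by rewrite /= fe !eqxx; case/andP: wp.
(* The walk [e :: p] has [#|E|.+1] arcs, so it repeats an arc and hence a source. *)
have [e [p [_ sp wp]]] := long #|E|.
apply/acyc/(walk_sources_uniq wp)/negP => /map_uniq/card_uniqP cp.
by have := max_card [in e :: p]; rewrite cp /= sp ltnn.
Qed.

(** * Reachability of the terminus from a set of vertices *)

(** Walks are used instead of paths because they can be cut and prolonged without checking
    distinctness. *)
Definition reaches S A : Prop :=
  exists u p, [/\ u \in S, is_walk G u t p & {subset p <= A}].

Lemma reaches_sub S A B : A \subset B -> reaches S A -> reaches S B.
Proof.
move=> /subsetP AB [u [p [uS wp pA]]]; exists u, p.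
by split=> // e /pA /AB.
Qed.

Lemma walk_setU1 u e A p : is_walk G u t p -> {subset p <= e |: A} ->
  exists q, (is_walk G u t q \/ is_walk G (tgt e) t q) /\ {subset q <= A}.
Proof.
elim: p u => [|f p IH] u /=; first by exists [::]; split=> //; left.
case/andP=> fu wp sp.
have fA : f \in e |: A by apply: sp; rewrite mem_head.
have /(IH _ wp)[q [wq qA]] : {subset p <= e |: A}.
  by move=> g gp; apply: sp; rewrite inE gp orbT.
case: wq => [wq|wq]; last by exists q; split=> //; right.
move: fA; rewrite !inE => /orP[/eqP <-|fA]; first by exists q; split=> //; right.
exists (f :: q); split; first by left; rewrite /= fu.
by move=> g; rewrite inE => /orP[/eqP ->|/qA].
Qed.

(** The part of a walk after its last use of [e] starts at [tgt e], hence again in [S]. *)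
Lemma reaches_into S A e : tgt e \in S -> `[< reaches S (e |: A) >] = `[< reaches S A >].
Proof.
move=> eS; apply: asbool_equiv_eq; split; last exact/reaches_sub/subsetUr.
case=> u [p [uS wp sp]]; have [q [[wq|wq] qA]] := walk_setU1 wp sp.
  by exists u, q.
by exists (tgt e), q.
Qed.

Lemma reaches_from S A e : src e \in S ->
  `[< reaches S (e |: A) >] = `[< reaches (tgt e :: S) A >].
Proof.
move=> eS; apply: asbool_equiv_eq; split=> -[u [p [uS wp sp]]].
  have [q [[wq|wq] qA]] := walk_setU1 wp sp.
    by exists u, q; rewrite inE uS orbT.
  by exists (tgt e), q; rewrite mem_head.
move: uS; rewrite inE => /orP[/eqP uE|uS]; last first.
  by exists u, p; split=> // f /sp fA; rewrite inE fA orbT.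
exists (src e), (e :: p); split=> //; first by rewrite /= eqxx -uE.
by move=> f; rewrite !inE => /orP[->//|/sp ->]; rewrite orbT.
Qed.

(** As nothing enters [src e], a walk could use [e] only as its first arc, but it starts in [S]. *)
Lemma reaches_isolated S A e : src e \notin S ->
    (forall f, f \in e |: A -> tgt f != src e) ->
  `[< reaches S (e |: A) >] = `[< reaches S A >].
Proof.
move=> eS noIn; apply: asbool_equiv_eq; split; last exact/reaches_sub/subsetUr.
case=> u [p [uS wp sp]]; exists u, p; split=> // f fp.
have := sp _ fp; rewrite !inE => /orP[/eqP fe|//].
rewrite fe in fp; have [eu|[g gp ge]] := walk_source wp fp.
  by rewrite eu uS in eS.
by have := noIn _ (sp _ gp); rewrite ge eqxx.
Qed.

Lemma reaches_stuck S A : t \notin S ->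
  (forall e, e \in A -> src e \notin S) -> `[< reaches S A >] = false.
Proof.
move=> tS noOut; apply: asboolF => -[u [[|e p] [uS /= wp sp]]].
  by rewrite -(eqP wp) uS in tS.
by have := noOut e (sp _ (mem_head _ _)); case/andP: wp => /eqP ->; rewrite uS.
Qed.

Lemma reaches_terminus S A : t \in S -> `[< reaches S A >].
Proof. by move=> tS; apply/asboolP; exists t, [::]; rewrite /= eqxx. Qed.

(** * The alternating sum of reachability and its recursion *)

Definition reach_sum S X := alt_sum X (fun A => `[< reaches S A >]).

Lemma reach_sum_into S X e : e \in X -> tgt e \in S -> reach_sum S X = 0.
Proof. by move=> eX eS; apply: (alt_sum_toggle eX) => A _; apply: reaches_into. Qed.

Lemma reach_sum_terminus S X : t \in S -> X != set0 -> reach_sum S X = 0.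
Proof.
move=> tS /set0Pn[e eX]; apply: (alt_sum_toggle eX) => A _.
by rewrite !reaches_terminus.
Qed.

Lemma reach_sumD1 S X e : e \in X -> src e \in S ->
  reach_sum S X = reach_sum S (X :\ e) - reach_sum (tgt e :: S) (X :\ e).
Proof.
move=> eX eS; rewrite /reach_sum (alt_sumD1 _ eX); congr (_ - _).
by apply: eq_alt_sum => A _; apply: reaches_from.
Qed.

(* [B] stands for the arc set of a cycle; only the existence of predecessors
   inside [B] matters. *)
Lemma reach_sum_cyclic B S X : B != set0 -> B \subset X ->
    (forall e, e \in B -> exists2 f, f \in B & tgt f = src e) ->
  reach_sum S X = 0.
Proof.
move=> B0 BX pred; have [n] := ubnP #|X|; elim: n => // n IH in S X BX *.
move=> leXn; have [/exists_inP[e eX eS]|/exists_inPn noIn] :=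
  boolP [exists e in X, tgt e \in S]; first exact: reach_sum_into eX eS.
have [/exists_inP[e eX eS]|/exists_inPn noOut] := boolP [exists e in X, src e \in S].
  (* An arc of [B] leaving [S] would have a predecessor ending in [S]. *)
  have eB : e \notin B.
    apply/negP => /pred[f /(subsetP BX)/noIn + fe].
    by rewrite fe eS.
  have BXe : B \subset X :\ e by rewrite subsetD1 BX.
  have ltXe : (#|X :\ e| < n)%N by move: leXn; rewrite (cardsD1 e X) eX; lia.
  by rewrite (reach_sumD1 eX eS) !IH // subrr.
(* No arc leaves [S]: either [t] lies in [S] and every arc set counts, or none does. *)
have [tS|tS] := boolP (t \in S).
  apply: reach_sum_terminus => //; apply: contraNneq B0 => X0.
  by rewrite X0 subset0 in BX.
apply: alt_sum_false => A /subsetP AX; apply: reaches_stuck => // e /AX.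
exact: noOut.
Qed.

(* [pred] and [succ], together with acyclicity, say that no arc is useless when
   [S] is contracted to the start vertex; [N] lists the nonsinks outside [S]. *)
Lemma reach_sum_acyclic N S X : ~ has_cycle G -> t \notin S -> X != set0 ->
    (forall e, e \in X -> tgt e \notin S) ->
    (forall e, e \in X -> src e != t) ->
    (forall e, e \in X -> src e \in S \/ exists2 f, f \in X & tgt f = src e) ->
    (forall e, e \in X -> tgt e = t \/ exists2 f, f \in X & src f = tgt e) ->
    uniq N -> (forall v, v \in N <-> v \notin S /\ exists2 e, e \in X & src e = v) ->
  reach_sum S X = (-1) ^+ (size N).+1.
Proof.
move=> acyc; have [n] := ubnP #|X|; elim: n => // n IH in N S X *.
move=> leXn tS X0 noIn noT pred succ uN NE.
(* Unless all arcs of [X] end at [t], choose [e] minimal among those that do not. A predecessor of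
   [e] in [X] would be another such arc, since no arc leaves [t]; hence [e] leaves [S]. The last
   clause will force [X] to be [[set e]] when [e] is the only arc ending at its target and this
   target is [t]. *)
have [e [eX eS et]] : exists e, [/\ e \in X, src e \in S &
    tgt e = t -> forall f, f \in X -> tgt f = t].
  have [Y0|Y0] := eqVneq [set f in X | tgt f != t] set0.
    have allT f : f \in X -> tgt f = t.
      move=> fX; apply/eqP/negPn/negP => ft.
      by have := in_set0 f; rewrite -Y0 inE fX ft.
    have /set0Pn[e eX] := X0; exists e; split=> //.
    have [//|[f /allT -> te]] := pred _ eX.
    by have := noT _ eX; rewrite te eqxx.
  have [e] := acyclic_minimal acyc Y0; rewrite inE => /andP[eX et] noPred.
  exists e; split=> // [|eqt]; last by rewrite eqt eqxx in et.
  have [//|[f fX fe]] := pred _ eX.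
  suff /noPred : f \in [set f in X | tgt f != t] by rewrite fe eqxx.
  by rewrite inE fX fe noT.
have ltXe : (#|X :\ e| < n)%N by move: leXn; rewrite (cardsD1 e X) eX; lia.
rewrite (reach_sumD1 eX eS).
have succ' f : f \in X :\ e -> tgt f = t \/ exists2 g, g \in X :\ e & src g = tgt f.
  case/setD1P=> _ fX; have [|[g gX gf]] := succ _ fX; [by left|right].
  exists g => //; rewrite !inE gX andbT; apply/eqP => ge.
  by have := noIn _ fX; rewrite -gf ge eS.
(* If another arc [e'] ends at [tgt e], the second term vanishes; in the first, [e'] replaces [e] as
   a predecessor and [N] is unchanged. *)
have [/exists_inP[e' e'X /eqP e'e]|/exists_inPn noOther] :=
    boolP [exists f in X :\ e, tgt f == tgt e].
  rewrite (@reach_sum_into (tgt e :: S) _ e') ?e'e ?mem_head // subr0.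
  apply: IH => //.
  - by apply/set0Pn; exists e'.
  - by move=> f /setD1P[_]; apply: noIn.
  - by move=> f /setD1P[_]; apply: noT.
  - move=> f /setD1P[_ fX]; have [|[g gX gf]] := pred _ fX; [by left|right].
    have [ge|ge] := eqVneq g e; first by exists e'; rewrite // e'e -ge.
    by exists g; rewrite // !inE ge.
  - move=> v; rewrite NE; split=> -[vS [f fX fv]]; split=> //; exists f => //.
      by rewrite !inE fX andbT; apply/eqP => fe; rewrite -fv fe eS in vS.
    by case/setD1P: fX.
have vS : tgt e \notin S := noIn _ eX.
(* Now [e] alone ends at [tgt e]. If this is [t], no other arc is left, [N] is empty and the
   difference is [0 - 1]. *)
have [vt|vt] := eqVneq (tgt e) t.
  have Xe0 : X :\ e = set0.
    apply/eqP/negPn/negP => /set0Pn[f fXe].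
    by have := noOther _ fXe; rewrite vt (et vt) ?eqxx //; case/setD1P: fXe.
  have N0 : N = [::].
    case: N {uN} NE => // v N /(_ v); rewrite mem_head => -[/(_ isT)[+ [f fX fv]] _].
    have [fe|fe] := eqVneq f e; first by rewrite -fv fe eS.
    by have := in_set0 f; rewrite -Xe0 !inE fe fX.
  rewrite /reach_sum Xe0 !alt_sum_set0 N0 reaches_stuck //; last by move=> f; rewrite inE.
  by rewrite reaches_terminus // vt mem_head.
have [//|[f fX fe]] := succ _ eX; first by move=> /eqP; rewrite (negPf vt).
have fXe : f \in X :\ e.
  by rewrite !inE fX andbT; apply/eqP => fe'; rewrite -fe fe' eS in vS.
(* With [e] removed nothing enters [tgt e], so toggling [f] kills the first term. *)
rewrite [reach_sum S _](@alt_sum_toggle _ _ _ f fXe) ?sub0r; last first.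
  move=> A /subsetP AX; apply: reaches_isolated; first by rewrite fe.
  move=> g gA; rewrite fe; apply: noOther.
  by move: gA; rewrite inE => /orP[/set1P -> //|/AX/setD1P[]].
have vN : tgt e \in N by apply/NE; split=> //; exists f.
(* In the second term [tgt e] passes from [N] into [S]; the minus sign makes up for the lost
   nonsink. *)
rewrite (IH (rem (tgt e) N)) //.
- by rewrite size_rem // prednK ?exprS ?mulN1r //; case: (N) vN.
- by rewrite inE negb_or eq_sym vt.
- by apply/set0Pn; exists f.
- move=> g gXe; rewrite inE negb_or noOther //=.
  by apply: noIn; case/setD1P: gXe.
- by move=> g /setD1P[_]; apply: noT.
- move=> g /setD1P[_ gX]; have [gS|[h hX hg]] := pred _ gX.
    by left; rewrite inE gS orbT.
  have [he|he] := eqVneq h e; first by left; rewrite -hg he mem_head.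
  by right; exists h; rewrite // !inE he.
- exact: rem_uniq.
- move=> v; rewrite mem_rem_uniq // !inE negb_or; split.
    case/andP=> ve /NE[vS' [g gX gv]]; rewrite ve; split=> //; exists g => //.
    by rewrite !inE gX andbT; apply/eqP => ge; rewrite -gv ge eS in vS'.
  case=> /andP[-> vS'] [g /setD1P[_ gX] gv] /=; apply/NE; split=> //.
  by exists g.
Qed.

(** * The start vertex and the path-missing complex *)

Lemma reaches_startE A : reaches [:: start G] A <-> contains_st_path G A.
Proof.
split=> [[u [p [/[!inE]/eqP -> wp pA]]]|[p [/andP[wp _] pA]]]; last first.
  by exists (start G), p; rewrite mem_head.
by have [q pq qp] := walk_to_path wp; exists q; split=> // e /qp /pA.
Qed.

Lemma reach_sum_useless X e : e \in X -> useless G e -> reach_sum [:: start G] X = 0.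
Proof.
move=> eX ue; apply: (alt_sum_toggle eX) => A _; apply: asbool_equiv_eq.
split; last exact/reaches_sub/subsetUr.
move=> /reaches_startE[p [stp pA]]; apply/reaches_startE; exists p; split=> // f fp.
have := pA _ fp; rewrite !inE => /orP[/eqP fe|//].
by case: ue; exists p; rewrite -fe.
Qed.

Lemma cycle_pred v p : is_cycle G v p ->
  forall e, e \in p -> exists2 f, f \in p & tgt f = src e.
Proof.
case/and3P=> wp p0 _ e ep; have [->|//] := walk_source wp ep.
have := walk_last wp; case: p {wp ep} p0 => // f p _ /= lv.
have /mapP[g gp ->] : v \in map tgt (f :: p) by rewrite -lv mem_last.
by exists g.
Qed.

Lemma reach_sum_has_cycle S : has_cycle G -> reach_sum S setT = 0.
Proof.
case=> v [p cp]; have pred := cycle_pred cp.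
apply: (@reach_sum_cyclic [set e in p]) => [||e].
- by case/and3P: cp; case: p {pred} => // e p _ _ _; apply/set0Pn; exists e; rewrite inE mem_head.
- exact: subsetT.
- by rewrite inE => /pred[f fp fe]; exists f; rewrite ?inE.
Qed.

(** All is read off a path from start to terminus through [e]; this supplies the local hypotheses of
    [reach_sum_acyclic] for [S = [:: start G]]. *)
Lemma useful_local e : ~ useless G e ->
  [/\ start G != t, tgt e != start G, src e != t,
      src e = start G \/ exists f, tgt f = src e &
      tgt e = t \/ exists f, src f = tgt e].
Proof.
move/contrapT => [p [/andP[wp up] ep]].
have lt := walk_last wp; have := ep; case/splitPr: ep wp up lt => p1 p2 wp up lt ep.
have ts : tgt e \in map tgt (p1 ++ e :: p2) by apply: map_f.
(* The terminus is the target of the last arc, hence is visited after [src e]. *)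
have tm : t \in map tgt (e :: p2).
  by rewrite -lt map_cat last_cat /= mem_last.
have tN : t \in map tgt (p1 ++ e :: p2) by rewrite map_cat mem_cat tm orbT.
move: (up) => /= /andP[sN uN]; split.
- by apply: contraNneq sN => ->.
- by apply: contraNneq sN => <-.
- move: up; rewrite map_cat -cat_cons cat_uniq => /and3P[_ /hasPn/(_ _ tm) + _].
  apply: contraNneq => <-; move: wp; rewrite is_walk_cat /= => /and3P[_ /eqP -> _].
  exact: mem_last.
- by have [|[f _ fe]] := walk_source wp ep; [left|right; exists f].
- by have [|[f _ fe]] := walk_target wp ep; [left|right; exists f].
Qed.

(** Complementation turns faces into arc sets containing a path from start to terminus, and
    [#|~: A| - 1] has the parity of [#|E| - 1 + #|A|]. *)
Lemma reduced_euler_charE :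
  reduced_euler_char (path_missing G) =
  (-1 : int) ^ (#|E|%:Z - 1) * reach_sum [:: start G] setT.
Proof.
rewrite /reduced_euler_char /reach_sum /alt_sum mulr_sumr.
rewrite (reindex_inj (@setC_inj E)) /= big_mkcond /=.
rewrite [RHS](eq_bigl xpredT) => [|A]; last by rewrite subsetT.
apply: eq_bigr => A _; rewrite inE setCK -(asbool_equiv_eq (reaches_startE A)).
case: asboolP => _; last by rewrite mulr0.
rewrite mulr1n -(cardsC A) PoszD -addrA addrC !sign_exprzD -!mulrA.
have -> : (-1 : int) ^ #|A|%:Z = (-1) ^+ #|A| by [].
by rewrite -expr2 sqrr_sign mulr1.
Qed.

End Walks.

Theorem theorem1p3 (V : eqType) (E : finType) (G : digraph V E) :
  ((exists e : E, useless G e) \/ has_cycle G \/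
     ([set: E] = set0 /\ start G <> terminus G) ->
   reduced_euler_char (path_missing G) = 0) /\
  (~ ((exists e : E, useless G e) \/ has_cycle G \/
        ([set: E] = set0 /\ start G <> terminus G)) ->
   reduced_euler_char (path_missing G) =
     (-1 : int) ^ (#|E|%:Z - (size (nonsinks G))%:Z + 1)).
Proof.
rewrite reduced_euler_charE; split.
  case=> [[e ue]|[cyc|[E0 /eqP st]]].
  - by rewrite (reach_sum_useless _ ue) ?mulr0.
  - by rewrite reach_sum_has_cycle ?mulr0.
  - rewrite /reach_sum E0 alt_sum_set0 reaches_stuck ?mulr0 // => [|e]; last by rewrite in_set0.
    by rewrite inE eq_sym.
move=> nCases; have acyc : ~ has_cycle G by move=> cyc; apply: nCases; right; left.
have useful e : ~ useless G e by move=> ue; apply: nCases; left; exists e.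
(* Without arcs the start is the terminus, the empty set is the only face, and both sides are
   [-1]. *)
have [E0|E0] := eqVneq [set: E] set0.
  have st : start G = terminus G.
    by apply: contrapT => st; apply: nCases; right; right.
  have cE : #|E| = 0%N by rewrite -cardsT E0 cards0.
  have -> : nonsinks G = [::].
    apply: size0nil; apply/eqP; rewrite -leqn0 -cE.
    by rewrite (leq_trans (size_undup _)) // size_codom.
  rewrite /reach_sum E0 alt_sum_set0 reaches_terminus ?st ?mem_head //.
  by rewrite cE.
have [e0 _] := set0Pn _ E0; have [st _ _ _ _] := useful_local (useful e0).
(* By acyclicity some arc has no predecessor; being useful, it must leave the start. *)
have startN : start G \in nonsinks G.
  have [e _ eMin] := acyclic_minimal acyc E0.
  have [_ _ _ [<-|[f fe]] _] := useful_local (useful e).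
    by rewrite mem_nonsinks; apply/existsP; exists e.
  by have := eMin f (in_setT _); rewrite fe eqxx.
(* Leaving the start out of [N] makes [(size N).+1] the number of nonsinks. *)
rewrite (@reach_sum_acyclic _ _ _ (rem (start G) (nonsinks G))) //.
- rewrite size_rem // prednK; last by case: (nonsinks G) startN.
  (* The two exponents differ by the even last summand. *)
  have -> : #|E|%:Z - (size (nonsinks G))%:Z + 1 =
      #|E|%:Z - 1 + (size (nonsinks G))%:Z + 2 * (1 - (size (nonsinks G))%:Z) by lia.
  by rewrite !sign_exprzD -exprz_exp (_ : (-1) ^ 2 = 1) // exp1rz mulr1.
- by rewrite inE eq_sym.
- by move=> e _; rewrite inE; have [] := useful_local (useful e).
- by move=> e _; have [] := useful_local (useful e).
- move=> e _; have [_ _ _ [->|[f fe]] _] := useful_local (useful e).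
    by left; rewrite mem_head.
  by right; exists f.
- move=> e _; have [_ _ _ _ [->|[f fe]]] := useful_local (useful e); first by left.
  by right; exists f.
- exact/rem_uniq/uniq_nonsinks.
- move=> v; rewrite mem_rem_uniq ?uniq_nonsinks // !inE mem_nonsinks; split.
    by case/andP=> -> /existsP[e /eqP ev]; split=> //; exists e.
  by case=> -> [e _ ev]; apply/existsP; exists e; rewrite ev.
Qed.
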